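(* In the setting of the context (time index $t$ suppressed), let $\tilde W_{BB}^{1/2}P^+_{BB}\tilde W_{BB}^{1/2}=U^\top D U$ be an eigen-decomposition, with $D=\mathrm{diag}_{1\le i\le d_B}(\sigma_i^2)$ and $U$ a real $d_B\times d_B$ matrix satisfying $UU^\top=U^\top U=I$. Then the optimizer of the problem $$\min_{X}\ \ \mathrm{tr}(\tilde W_{BB}X)-\tfrac{\alpha}{2}\log\det X\quad\text{s.t.}\quad X\preceq P^+_{BB},$$ over symmetric positive definite $X\in\mathbb{R}^{d_B\times d_B}$, is $$P_{BB}^*=\tilde W_{BB}^{-1/2}U^\top\Phi\,U\tilde W_{BB}^{-1/2},\qquad \Phi=\mathrm{diag}_{1\le i\le d_B}\big(\min\{\tfrac{\alpha}{2},\sigma_i^2\}\big).$$ Moreover, $$M:=(P_{BB}^* )^{-1}-(P_{BB}^+)^{-1}=\tilde W_{BB}^{1/2}U^\top\Sigma\,U\tilde W_{BB}^{1/2},\qquad \Sigma=\mathrm{diag}_{1\le i\le d_B}\big(\max\{0,\tfrac{2}{\alpha}-\tfrac{1}{\sigma_i^2}\}\big).$$ The optimum compression and quantization levels, i.e. an optimal solution $(\Theta^*,N^* )$, with $d_{\Theta^*}$ equal to the number of rows of $\Theta^*$, of the compression design problem (CD) defined in the context, are given by $$(\Theta^*,(N^* )^{-1})=\mathrm{RSD}(M).$$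
   Context: Let $1\le d_B\le d$ be integers and $\alpha>0$; $\log$ is the natural logarithm. $C_B\in\{0,1\}^{d_B\times d}$ is a selection matrix (its rows are distinct standard basis row vectors of $\mathbb{R}^d$), $C_O\in\{0,1\}^{(d-d_B)\times d}$ is the selection matrix whose rows are the remaining standard basis vectors. $P^+\in\mathbb{R}^{d\times d}$ is a given symmetric positive definite matrix, and $P^+_{BB}=C_BP^+C_B^\top$, $P^+_{OB}=C_OP^+C_B^\top$. $W=\mathrm{diag}(w)$ is the $d\times d$ diagonal weight matrix with $w_j=\max_{p\in\pi}\exp(-\|p_j-p\|^2/(2\sigma^2))>0$, where $p_1,\dots,p_d\in\mathbb{R}^2$ are cell positions, $\pi$ is a nonempty subset of the cells (a path), and $\sigma>0$ (unrelated to the $\sigma_i$). Set $W_{BB}=C_BWC_B^\top$, $W_{OO}=C_OWC_O^\top$, $Q=P^+_{OB}(P^+_{BB})^{-1}$, and $\tilde W_{BB}=W_{BB}+Q^\top W_{OO}Q$ (a symmetric positive definite matrix); $\tilde W_{BB}^{1/2}$ is its symmetric positive definite square root. Compression design problem (CD): over $d_\Theta\in\{0,1,\dots,d_B\}$, full-row-rank $\Theta\in\mathbb{R}^{d_\Theta\times d_B}$, and diagonal $N\in\mathbb{R}^{d_\Theta\times d_\Theta}$ with strictly positive diagonal entries, minimize $$\mathrm{tr}(WP)+\tfrac{\alpha}{2}\log\det(\Theta C_BP^+C_B^\top\Theta^\top+N)-\tfrac{\alpha}{2}\log\det(N),$$ where $P=((P^+)^{-1}+C_B^\top\Theta^\top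 N^{-1}\Theta C_B)^{-1}$. When $d_\Theta=0$, $\Theta^\top N^{-1}\Theta$ is the zero matrix and both log-determinants are $0$. Reduced decomposition operator RSD: for a symmetric positive semidefinite matrix $A$ with eigen-decomposition $A=V^\top\Lambda V$ ($V$ orthogonal, rows of $V$ being eigenvectors, $\Lambda$ diagonal), $\mathrm{RSD}(A)=(V_+,\Lambda_+)$, where $\Lambda_+$ is the diagonal matrix of the strictly positive eigenvalues and $V_+$ consists of the corresponding rows of $V$; thus $A=V_+^\top\Lambda_+V_+$. (RSD depends on the choice of eigen-decomposition; the claim holds for any choice.) *)

(* Defs.v *)
From mathcomp Require Import all_boot all_order all_algebra.
From mathcomp Require Import reals sequences exp.

Set Implicit Arguments.
Unset Strict Implicit.
Unset Printing Implicit Defensive.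

Import Order.TTheory GRing.Theory Num.Theory.
Local Open Scope ring_scope.

Definition psdmx (R : realType) (n : nat) (A : 'M[R]_n) : Prop :=
  A^T = A /\ forall x : 'cV[R]_n, 0 <= (x^T *m A *m x) 0 0.

Definition posdefmx (R : realType) (n : nat) (A : 'M[R]_n) : Prop :=
  A^T = A /\ forall x : 'cV[R]_n, x != 0 -> 0 < (x^T *m A *m x) 0 0.

Definition lownerle (R : realType) (n : nat) (A B : 'M[R]_n) : Prop :=
  psdmx (B - A).

(* The symmetric positive definite square root of a symmetric positive definite
   matrix is unique, so it is introduced by its defining property. *)
Definition is_sqrtmx (R : realType) (n : nat) (S A : 'M[R]_n) : Prop :=
  posdefmx S /\ S *m S = A.

Definition is_eigendecomp (R : realType) (n : nat)
    (A V : 'M[R]_n) (lam : 'rV[R]_n) : Prop :=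
  [/\ V *m V^T = 1%:M, V^T *m V = 1%:M & A = V^T *m diag_mx lam *m V].

Definition is_minimizer (R : realType) (T : Type)
    (feasible : T -> Prop) (obj : T -> R) (x : T) : Prop :=
  feasible x /\ forall y, feasible y -> obj x <= obj y.

Definition is_selection (R : realType) (m d : nat) (C : 'M[R]_(m, d)) : Prop :=
  (forall i, exists j, row i C = delta_mx 0 j) /\
  injective (fun i => row i C).

Definition complementary_selection (R : realType) (m n d : nat)
    (CB : 'M[R]_(m, d)) (CO : 'M[R]_(n, d)) : Prop :=
  forall j : 'I_d,
    (exists i, row i CO = delta_mx 0 j) <->
    ~ (exists i, row i CB = delta_mx 0 j).

(* The library norm on matrices is the sup norm, hence an explicit Euclidean
   distance. *)
Definition sqdist (R : realType) (x y : 'rV[R]_2) : R :=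
  \sum_k (x 0 k - y 0 k) ^+ 2.

(* For nonempty [path_cells], the default value 0 of the iterated maximum is harmless:
   all terms are positive. *)
Definition weight (R : realType) (d : nat) (pos : 'I_d -> 'rV[R]_2)
    (path_cells : {set 'I_d}) (sigma : R) (j : 'I_d) : R :=
  \big[Num.max/0]_(k in path_cells)
    expR (- sqdist (pos j) (pos k) / (2 * sigma ^+ 2)).

Definition weightmx (R : realType) (d : nat) (pos : 'I_d -> 'rV[R]_2)
    (path_cells : {set 'I_d}) (sigma : R) : 'M[R]_d :=
  diag_mx (\row_j weight pos path_cells sigma j).

Definition block (R : realType) (m n d : nat)
    (C : 'M[R]_(m, d)) (A : 'M[R]_d) (C' : 'M[R]_(n, d)) : 'M[R]_(m, n) :=
  C *m A *m C'^T.

Definition tildeW (R : realType) (m n d : nat)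
    (CB : 'M[R]_(m, d)) (CO : 'M[R]_(n, d)) (W Pp : 'M[R]_d) : 'M[R]_m :=
  let Q := block CO Pp CB *m invmx (block CB Pp CB) in
  block CB W CB + Q^T *m block CO W CO *m Q.

Definition reduced_feasible (R : realType) (n : nat) (PBB X : 'M[R]_n) : Prop :=
  posdefmx X /\ lownerle X PBB.

Definition reduced_obj (R : realType) (n : nat) (alpha : R)
    (Wt X : 'M[R]_n) : R :=
  \tr (Wt *m X) - alpha / 2 * ln (\det X).

Definition CD_feasible (R : realType) (dB k : nat)
    (Theta : 'M[R]_(k, dB)) (N : 'M[R]_k) : Prop :=
  [/\ (k <= dB)%N, row_free Theta, is_diag_mx N & forall i, 0 < N i i].

(* For k = 0 the library conventions already give Theta^T N^-1 Theta = 0 and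
   determinants equal to 1, so both log-determinants vanish. *)
Definition CD_obj (R : realType) (d dB k : nat) (alpha : R)
    (CB : 'M[R]_(dB, d)) (W Pp : 'M[R]_d)
    (Theta : 'M[R]_(k, dB)) (N : 'M[R]_k) : R :=
  let P := invmx (invmx Pp + CB^T *m Theta^T *m invmx N *m Theta *m CB) in
  \tr (W *m P)
  + alpha / 2 * ln (\det (Theta *m CB *m Pp *m CB^T *m Theta^T + N))
  - alpha / 2 * ln (\det N).

Definition CD_optimal (R : realType) (d dB k : nat) (alpha : R)
    (CB : 'M[R]_(dB, d)) (W Pp : 'M[R]_d)
    (Theta : 'M[R]_(k, dB)) (N : 'M[R]_k) : Prop :=
  CD_feasible Theta N /\
  forall (k' : nat) (Theta' : 'M[R]_(k', dB)) (N' : 'M[R]_k'),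
    CD_feasible Theta' N' ->
    CD_obj alpha CB W Pp Theta N <= CD_obj alpha CB W Pp Theta' N'.

(* RSD depends on the eigen-decomposition V^T diag(lam) V and not only on the
   matrix decomposed, hence it is a function of (V, lam). *)
Definition pos_index (R : realType) (n : nat) (lam : 'rV[R]_n) : {set 'I_n} :=
  [set i | 0 < lam 0 i].

Definition RSD (R : realType) (n : nat) (V : 'M[R]_n) (lam : 'rV[R]_n) :
    'M[R]_(#|pos_index lam|, n) * 'M[R]_(#|pos_index lam|) :=
  (rowsub (@enum_val _ (pos_index lam)) V,
   diag_mx (\row_k lam 0 (@enum_val _ (pos_index lam) k))).

(* Main.v *)
(* With T := U S, the congruence X |-> T X T^T turns the reduced problem into the
   minimization of tr Y - (alpha/2) log det Y under Y <= D := diag(sigma_i^2).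
   Bounding log det by its tangent plane at Phi leaves a separable function of
   the diagonal entries of Y, for which Y_ii <= sigma_i^2 suffices; equality in
   the tangent bound forces Y = Phi.

   For the compression design problem, put K := Theta^T N^-1 Theta and
   X := (PBB^-1 + K)^-1, which is always feasible for the reduced problem.
   Woodbury's identity gives P = P^+ + G (X - PBB) G^T with
   G = P^+ CB^T PBB^-1 = CB^T + CO^T Q, so G^T W G = Wt because W is diagonal,
   and Sylvester's identity gives det(Theta PBB Theta^T + N) / det N
   = det PBB / det X. Hence the two objectives differ by a constant, and RSD(M)
   is a pair with K = M, i.e. X = PBB^*. *)
Require Import Defs.
From mathcomp Require Import all_boot all_order all_algebra.
From mathcomp Require Import reals sequences exp.
From mathcomp Require Import ring lra.

Set Implicit Arguments.
Unset Strict Implicit.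
Unset Printing Implicit Defensive.

Import Order.TTheory GRing.Theory Num.Theory.
Local Open Scope ring_scope.

(** * Positive definite and semidefinite matrices *)

Lemma psdmx_congr (R : realType) (m n : nat) (A : 'M[R]_n) (T : 'M[R]_(n, m)) :
  psdmx A -> psdmx (T^T *m A *m T).
Proof.
move=> [symA psdA]; split; first by rewrite !trmx_mul trmxK symA mulmxA.
by move=> x; have := psdA (T *m x); rewrite trmx_mul !mulmxA.
Qed.

(** The left inverse [L] makes [T] injective. A rectangular [T] is allowed, so that principal blocks
    such as [C P C^T] are covered. *)
Lemma posdefmx_congr (R : realType) (m n : nat) (A : 'M[R]_n)
    (T : 'M[R]_(n, m)) (L : 'M[R]_(m, n)) :
  L *m T = 1%:M -> posdefmx A -> posdefmx (T^T *m A *m T).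
Proof.
move=> LT [symA pdA]; split; first by rewrite !trmx_mul trmxK symA mulmxA.
move=> x x0; have Tx0 : T *m x != 0.
  apply: contraNneq x0 => Tx0.
  by rewrite -[x]mul1mx -LT -mulmxA Tx0 mulmx0.
by have := pdA _ Tx0; rewrite trmx_mul !mulmxA.
Qed.

Lemma posdefmx_psd (R : realType) (n : nat) (A : 'M[R]_n) :
  posdefmx A -> psdmx A.
Proof.
move=> [symA pdA]; split=> // x; have [->|/pdA/ltW//] := eqVneq x 0.
by rewrite mulmx0 mxE.
Qed.

Lemma psdmxD (R : realType) (n : nat) (A B : 'M[R]_n) :
  psdmx A -> psdmx B -> psdmx (A + B).
Proof.
move=> [symA psdA] [symB psdB]; split; first by rewrite linearD /= symA symB.
by move=> x; rewrite mulmxDr mulmxDl mxE addr_ge0.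
Qed.

Lemma posdefmxD (R : realType) (n : nat) (A B : 'M[R]_n) :
  posdefmx A -> psdmx B -> posdefmx (A + B).
Proof.
move=> [symA pdA] [symB psdB]; split; first by rewrite linearD /= symA symB.
by move=> x x0; rewrite mulmxDr mulmxDl mxE ltr_wpDr ?pdA.
Qed.

Lemma posdefmx_unit (R : realType) (n : nat) (A : 'M[R]_n) :
  posdefmx A -> A \in unitmx.
Proof.
move=> [_ pdA]; rewrite -row_free_unit; apply: inj_row_free => v vA0.
apply/eqP; apply: contraT => v0; have /pdA : v^T != 0 by rewrite trmx_eq0.
by rewrite trmxK vA0 mul0mx mxE ltxx.
Qed.

Lemma posdefmx_inv (R : realType) (n : nat) (A : 'M[R]_n) :
  posdefmx A -> posdefmx (invmx A).
Proof.
move=> pdA; have uA := posdefmx_unit pdA.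
have := posdefmx_congr (mulmxV uA) pdA.
by rewrite trmx_inv (proj1 pdA) mulVmx // mul1mx.
Qed.

Lemma quad_delta (R : realType) (n : nat) (A : 'M[R]_n) (i : 'I_n) :
  ((delta_mx i 0 : 'cV_n)^T *m A *m (delta_mx i 0 : 'cV_n)) 0 0 = A i i.
Proof. by rewrite trmx_delta -rowE -colE !mxE. Qed.

Lemma psdmx_diag_ge0 (R : realType) (n : nat) (A : 'M[R]_n) i :
  psdmx A -> 0 <= A i i.
Proof. by move=> [_ /(_ (delta_mx i 0))]; rewrite quad_delta. Qed.

Lemma posdefmx_diag_gt0 (R : realType) (n : nat) (A : 'M[R]_n) i :
  posdefmx A -> 0 < A i i.
Proof.
move=> [_ /(_ (delta_mx i 0))]; rewrite quad_delta; apply.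
by apply/matrix0Pn; exists i, 0; rewrite mxE !eqxx oner_neq0.
Qed.

Lemma quad_diag (R : realType) (n : nat) (e : 'rV[R]_n) (x : 'cV[R]_n) :
  (x^T *m diag_mx e *m x) 0 0 = \sum_i e 0 i * x i 0 ^+ 2.
Proof.
rewrite mul_mx_diag mxE; apply: eq_bigr => i _; rewrite !mxE; ring.
Qed.

Lemma psdmx_diag (R : realType) (n : nat) (e : 'rV[R]_n) :
  (forall i, 0 <= e 0 i) -> psdmx (diag_mx e).
Proof.
move=> e_ge0; split=> [|x]; first exact: tr_diag_mx.
by rewrite quad_diag sumr_ge0 // => i _; rewrite mulr_ge0 ?sqr_ge0.
Qed.

Lemma posdefmx_diag (R : realType) (n : nat) (e : 'rV[R]_n) :
  (forall i, 0 < e 0 i) -> posdefmx (diag_mx e).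
Proof.
move=> e_gt0; split=> [|x /matrix0Pn[i [j]]]; first exact: tr_diag_mx.
rewrite ord1 quad_diag (bigD1 i) //= => xi0.
rewrite ltr_wpDr ?sumr_ge0 // => [k _|]; first by rewrite mulr_ge0 ?sqr_ge0 ?ltW.
by rewrite mulr_gt0 // exprn_even_gt0.
Qed.

Lemma invmx_uniq (R : realType) (n : nat) (A B : 'M[R]_n) :
  A *m B = 1%:M -> invmx A = B.
Proof. by move=> AB; rewrite -[LHS]mulmx1 -AB mulKmx //; case/mulmx1_unit: AB. Qed.

Lemma invmx_diag (R : realType) (n : nat) (e : 'rV[R]_n) :
  (forall i, e 0 i != 0) -> invmx (diag_mx e) = diag_mx (\row_i (e 0 i)^-1).
Proof.
move=> e0; apply: invmx_uniq; rewrite mulmx_diag; apply/matrixP => i j.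
rewrite !mxE; case: (i =P j) => [->|_]; rewrite ?mulr0n // mulr1n.
by rewrite divff.
Qed.

(** * Schur complements and the tangent bound for log det *)

(** One step of symmetric Gaussian elimination: a unit lower triangular [L] brings [Y] by congruence
    to the block diagonal matrix with blocks [Y 0 0] and [Y']. This drives the inductions on the
    dimension below. *)
Lemma posdefmx_schur (R : realType) (n : nat) (Y : 'M[R]_(1 + n)) :
  let Y' := drsubmx Y - (Y 0 0)^-1 *: (dlsubmx Y *m ursubmx Y) in
  posdefmx Y -> posdefmx Y' /\ \det Y = Y 0 0 * \det Y'.
Proof.
move=> Y' pdY; have a0 : Y 0 0 != 0 by rewrite gt_eqF ?posdefmx_diag_gt0.
pose L : 'M[R]_(1 + n) := block_mx 1%:M 0 (- (Y 0 0)^-1 *: dlsubmx Y) 1%:M.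
have trY : dlsubmx Y = (ursubmx Y)^T by rewrite trmx_ursub (proj1 pdY).
have Yul : ulsubmx Y = (Y 0 0)%:M.
  by rewrite [LHS]mx11_scalar !mxE; congr (Y _ _)%:M; apply/val_inj.
have LY : L *m Y = block_mx (Y 0 0)%:M (ursubmx Y) 0 Y'.
  rewrite -{1}(submxK Y) Yul /L mulmx_block !mul1mx !mul0mx !addr0.
  congr block_mx.
    by rewrite mul_mx_scalar scalerA mulrN divff // scaleN1r addNr.
  by rewrite -scalemxAl scaleNr addrC.
have detL : \det L = 1 by rewrite det_lblock !det1 mulr1.
have uL : L \in unitmx by rewrite unitmxE detL unitr1.
have uLT : L^T \in unitmx by rewrite unitmx_tr.
have LYL : L *m Y *m L^T = block_mx (Y 0 0)%:M 0 0 Y'.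
  rewrite LY tr_block_mx mulmx_block !trmx1 !trmx0 !mulmx0 !mul0mx.
  rewrite !mulmx1 !addr0 add0r linearZ /= trY trmxK -scalemxAr.
  by rewrite mul_scalar_mx scalerA mulNr mulVf // scaleN1r addNr.
have := posdefmx_congr (mulVmx uLT) pdY; rewrite trmxK LYL => pdB.
split; last first.
  by rewrite -[LHS]mul1r -detL -det_mulmx LY det_ublock det_scalar1.
(* Congruence by this column of blocks extracts the lower right block. *)
have := posdefmx_congr (L := row_mx 0 1%:M) (T := col_mx 0 1%:M) _ pdB.
rewrite tr_col_mx trmx0 trmx1 mul_row_block !mul_row_col.
by rewrite !(mul0mx, mulmx0, mul1mx, mulmx1, add0r, addr0); apply.
Qed.

Lemma posdefmx_det_gt0 (R : realType) (n : nat) (Y : 'M[R]_n) :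
  posdefmx Y -> 0 < \det Y.
Proof.
elim: n Y => [|n IHn] Y pdY; first by rewrite det_mx00.
have [/IHn pdY' ->] := posdefmx_schur (Y := (Y : 'M_(1 + n))) pdY.
by rewrite mulr_gt0 ?posdefmx_diag_gt0.
Qed.

(** This is [1 + u < expR u] for nonzero [u], taken at [u = ln (y / x)]. The equality case is kept
    because uniqueness of the minimizer rests on it. *)
Lemma ln_tangent (R : realType) (x y : R) : 0 < x -> 0 < y ->
  ln y <= ln x + y / x - 1 ?= iff (y == x).
Proof.
move=> x0 y0; have yx : 0 < y / x by rewrite divr_gt0.
have lnE : ln (y / x) = ln y - ln x by rewrite ln_div.
apply/leifP; have [->|nyx] := eqVneq; first by rewrite divff ?lt0r_neq0 // addrK.
have : ln (y / x) != 0.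
  by rewrite lnE subr_eq0; apply: contra_neq nyx => /(@ln_inj R _ _ y0 x0).
move/expR_gt1Dx; rewrite lnK ?posrE // lnE; lra.
Qed.

(* Tangent plane inequality for the strictly concave function [ln \det] at a
   diagonal matrix, by induction on Schur complements. *)
Lemma ln_det_tangent (R : realType) (n : nat) (e : 'rV[R]_n) (Y : 'M[R]_n) :
  (forall i, 0 < e 0 i) -> posdefmx Y ->
  let r := \sum_i (ln (e 0 i) + Y i i / e 0 i - 1) in
  ln (\det Y) <= r /\ (ln (\det Y) = r -> Y = diag_mx e).
Proof.
elim: n e Y => [|n IHn] e Y e_gt0 pdY /=.
  by rewrite big_ord0 det_mx00 ln1; split=> // _; apply/matrixP => -[].
have [] := posdefmx_schur (Y := (Y : 'M_(1 + n))) pdY.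
set Y' := (X in posdefmx X) => pdY' detY.
have a_gt0 : 0 < Y 0 0 by rewrite posdefmx_diag_gt0.
pose e' : 'rV[R]_n := \row_j e 0 (lift ord0 j).
have e'_gt0 i : 0 < e' 0 i by rewrite mxE.
have [Y'_le Y'_eq] := IHn e' Y' e'_gt0 pdY'.
have [t_le t_eq] := ln_tangent (e_gt0 0) a_gt0.
have -> : ln (\det Y) = ln (Y 0 0) + ln (\det Y').
  by rewrite detY lnM // posrE // posdefmx_det_gt0.
have symY i j : Y j i = Y i j by rewrite -[in LHS](proj1 pdY) mxE.
have Y'E i j : Y' i j = Y (lift ord0 i) (lift ord0 j)
    - (Y 0 0)^-1 * (Y 0 (lift ord0 i) * Y 0 (lift ord0 j)).
  rewrite !mxE big_ord1 !mxE !rshift1 /= lshift0 !(symY _ 0).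
  by congr (_ - _ * (Y _ _ * Y _ _)); apply/val_inj.
(* Passing to the Schur complement subtracts [Y 0 i ^+ 2 / Y 0 0] from a diagonal entry, a strict
   decrease unless the border entry vanishes. *)
have Y'ii i : ln (e' 0 i) + Y' i i / e' 0 i - 1
    <= ln (e 0 (lift ord0 i)) + Y (lift ord0 i) (lift ord0 i) / e 0 (lift ord0 i) - 1
    ?= iff (Y 0 (lift ord0 i) == 0).
  rewrite mxE Y'E; apply/leifP; have [->|b0] := eqVneq.
    by rewrite !mulr0 subr0.
  rewrite ltrD2r ltrD2l ltr_pM2r ?invr_gt0 // ltrBlDr ltrDl.
  by rewrite mulr_gt0 ?invr_gt0 // -expr2 exprn_even_gt0.
rewrite big_ord_recl /=.
have [/= s_le s_eq] := leif_sum (P := predT) (fun i _ => Y'ii i).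
split=> [|E]; first by lra.
(* The bound for [ln (\det Y)] chains three inequalities: the scalar tangent at [Y 0 0], the
   induction hypothesis for [Y'], and the diagonal comparison. Equality overall makes each of them
   tight; the last one kills the border. *)
have b0 : forall i, Y 0 (lift ord0 i) = 0.
  have : \sum_i (ln (e' 0 i) + Y' i i / e' 0 i - 1) ==
    \sum_(i < n) (ln (e 0 (lift ord0 i))
      + Y (lift ord0 i) (lift ord0 i) / e 0 (lift ord0 i) - 1).
    by apply/eqP; lra.
  by rewrite s_eq => /forallP b0 i; apply/eqP/(b0 i).
have a_eq : Y 0 0 = e 0 0.
  by apply/eqP; rewrite -t_eq; apply/eqP; lra.
have /Y'_eq Y'D : ln (\det Y') = \sum_i (ln (e' 0 i) + Y' i i / e' 0 i - 1).
  by lra.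
apply/matrixP => i j; rewrite mxE.
case: (unliftP ord0 i) => [i'|] ->; case: (unliftP ord0 j) => [j'|] ->.
- move/matrixP/(_ i' j'): Y'D; rewrite Y'E !b0 !mulr0 subr0 !mxE => ->.
  by rewrite (inj_eq lift_inj).
- by rewrite symY b0.
- by rewrite b0.
- by rewrite eqxx a_eq.
Qed.

(** * The reduced problem, first for diagonal data and then by congruence *)

Lemma ln_prod (R : realType) (I : finType) (F : I -> R) :
  (forall i, 0 < F i) -> ln (\prod_i F i) = \sum_i ln (F i).
Proof.
(* Positivity is carried along because [lnM] needs positive factors. *)
move=> F0; suff [] : 0 < \prod_i F i /\ ln (\prod_i F i) = \sum_i ln (F i) by [].
apply: (big_ind2 (fun x y => 0 < x /\ ln x = y)) => //; first by rewrite ln1.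
by move=> x _ y _ [x0 <-] [y0 <-]; rewrite mulr_gt0 // lnM.
Qed.

Lemma reduced_diag_optimal (R : realType) (n : nat) (alpha : R) (s : 'rV[R]_n)
    (Y : 'M[R]_n) :
  0 < alpha -> (forall i, 0 < s 0 i) -> reduced_feasible (diag_mx s) Y ->
  let D := diag_mx (\row_i Num.min (alpha / 2) (s 0 i)) in
  reduced_obj alpha 1%:M D <= reduced_obj alpha 1%:M Y
  /\ (reduced_obj alpha 1%:M Y = reduced_obj alpha 1%:M D -> Y = D).
Proof.
move=> alpha0 s0 [pdY YleD]; set phi := \row_i _ => D; set a := alpha / 2.
have a0 : 0 < a by rewrite divr_gt0.
have phi0 i : 0 < phi 0 i by rewrite mxE lt_min a0 s0.
have [ldY_le ldY_eq] := ln_det_tangent phi0 pdY.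
have termP i : phi 0 i - a * ln (phi 0 i)
    <= Y i i - a * (ln (phi 0 i) + Y i i / phi 0 i - 1).
  (* First-order optimality of the clipped value: either [phi = a] and the slope [1 - a / phi]
     vanishes, or [phi = s] is the upper limit for [Y i i] and the slope is nonpositive. *)
  have : 0 <= (1 - a / phi 0 i) * (Y i i - phi 0 i).
    have Yis : Y i i <= s 0 i.
      by have := psdmx_diag_ge0 i YleD; rewrite !mxE eqxx subr_ge0.
    rewrite [phi 0 i]mxE -/a; case: (leP a (s 0 i)) => [_|/ltW sa].
      by rewrite divff ?lt0r_neq0 // subrr mul0r.
    by rewrite mulr_le0 // ?subr_le0 // ler_pdivlMr // mul1r.
  have -> : (1 - a / phi 0 i) * (Y i i - phi 0 i)
      = Y i i - a * (Y i i / phi 0 i - 1) - phi 0 i.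
    by field; exact: lt0r_neq0.
  lra.
have objD : reduced_obj alpha 1%:M D = \sum_i (phi 0 i - a * ln (phi 0 i)).
  by rewrite /reduced_obj mul1mx mxtrace_diag det_diag -/a sumrB -mulr_sumr ln_prod.
have objY : reduced_obj alpha 1%:M Y = \tr Y - a * ln (\det Y).
  by rewrite /reduced_obj mul1mx.
have sumY : \sum_i (Y i i - a * (ln (phi 0 i) + Y i i / phi 0 i - 1))
    = \tr Y - a * \sum_i (ln (phi 0 i) + Y i i / phi 0 i - 1).
  by rewrite sumrB -mulr_sumr.
have le1 := ler_sum (P := predT) (index_enum _) (fun i _ => termP i).
have le2 : a * ln (\det Y) <= a * \sum_i (ln (phi 0 i) + Y i i / phi 0 i - 1).
  by rewrite ler_pM2l.
rewrite objD objY; split; first by move: le1; rewrite sumY /=; lra.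
(* With equal objectives, [le1] and [le2] squeeze the tangent bound into an equality. *)
move=> E; apply: ldY_eq; apply: (mulfI (lt0r_neq0 a0)).
move: le1; rewrite sumY /=; lra.
Qed.

(** The correction term is independent of [X], so congruence by [T] preserves comparisons of
    objectives. *)
Lemma reduced_obj_congr (R : realType) (n : nat) (alpha : R) (T X : 'M[R]_n) :
  T \in unitmx -> posdefmx X ->
  reduced_obj alpha (T^T *m T) X = reduced_obj alpha 1%:M (T *m X *m T^T)
    + alpha / 2 * ln (\det T * \det T^T).
Proof.
move=> uT pdX; have dT : 0 < \det T * \det T^T.
  by rewrite det_tr -expr2 exprn_even_gt0 //= -unitfE -unitmxE.
rewrite /reduced_obj mul1mx -mulmxA (mxtrace_mulC T^T).
by rewrite !det_mulmx (mulrAC (\det T)) lnM ?posrE ?posdefmx_det_gt0 //; ring.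
Qed.

Lemma reduced_feasible_congr (R : realType) (n : nat) (P X T : 'M[R]_n) :
  T \in unitmx -> reduced_feasible P X ->
  reduced_feasible (T *m P *m T^T) (T *m X *m T^T).
Proof.
move=> uT [pdX XleP]; have uTT : T^T \in unitmx by rewrite unitmx_tr.
split; first by have := posdefmx_congr (mulVmx uTT) pdX; rewrite trmxK.
have := psdmx_congr T^T XleP.
by rewrite trmxK mulmxBr mulmxBl.
Qed.

Lemma reduced_diag_feasible (R : realType) (n : nat) (a : R) (s : 'rV[R]_n) :
  0 < a -> (forall i, 0 < s 0 i) ->
  reduced_feasible (diag_mx s) (diag_mx (\row_i Num.min a (s 0 i))).
Proof.
move=> a0 s0; split; first by apply: posdefmx_diag => i; rewrite mxE lt_min a0 s0.
rewrite /lownerle -linearB /=; apply: psdmx_diag => i.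
by rewrite !mxE subr_ge0 ge_min lexx orbT.
Qed.

Lemma congr_invmxK (R : realType) (n : nat) (T D : 'M[R]_n) :
  T \in unitmx -> T *m (invmx T *m D *m (invmx T)^T) *m T^T = D.
Proof.
move=> uT; rewrite -!mulmxA -trmx_mul mulmxV // trmx1 mulmx1 mulmxA.
by rewrite mulmxV ?mul1mx.
Qed.

(** A single [T] reduces the weight [T^T T] to the identity and the constraint matrix [P] to a
    diagonal one. The equivalence contains both existence and uniqueness of the minimizer. *)
Lemma reduced_minimizerP (R : realType) (n : nat) (alpha : R) (T P : 'M[R]_n)
    (s : 'rV[R]_n) (X : 'M[R]_n) :
  0 < alpha -> T \in unitmx -> (forall i, 0 < s 0 i) ->
  T *m P *m T^T = diag_mx s ->
  is_minimizer (reduced_feasible P) (reduced_obj alpha (T^T *m T)) X <->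
  X = invmx T *m diag_mx (\row_i Num.min (alpha / 2) (s 0 i)) *m (invmx T)^T.
Proof.
move=> alpha0 uT s0 TPT; set D := diag_mx _; set Xs := _ *m _ *m _.
have a0 : 0 < alpha / 2 by rewrite divr_gt0.
have TXs : T *m Xs *m T^T = D by exact: congr_invmxK.
have TinvK Z : invmx T *m (T *m Z *m T^T) *m (invmx T)^T = Z.
  by have := congr_invmxK Z (T := invmx T); rewrite unitmx_inv invmxK; apply.
have fXs : reduced_feasible P Xs.
  rewrite -(TinvK P) TPT /Xs; apply: reduced_feasible_congr.
    by rewrite unitmx_inv.
  exact: reduced_diag_feasible.
have cmp Y : reduced_feasible P Y ->
    reduced_obj alpha (T^T *m T) Xs <= reduced_obj alpha (T^T *m T) Y
    /\ (reduced_obj alpha (T^T *m T) Y = reduced_obj alpha (T^T *m T) Xs -> Y = Xs).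
  move=> fY; have [[pdXs _] [pdY _]] := (fXs, fY); rewrite !reduced_obj_congr //.
  have := reduced_feasible_congr uT fY; rewrite TPT TXs.
  move=> /(reduced_diag_optimal alpha0 s0)[le eq]; split; first by rewrite lerD2r.
  by move=> /addIr/eq E; rewrite -(TinvK Y) E.
split=> [[fX Xmin]|->]; last by split=> // Y /cmp[].
by have [le eq] := cmp _ fX; apply/eq/le_anti; rewrite le Xmin.
Qed.

(** * Sylvester's identity and selection matrices *)

(* Sylvester's determinant identity. *)
Lemma det_add1_mulmxC (R : comPzRingType) (m n : nat) (A : 'M[R]_(m, n))
    (B : 'M[R]_(n, m)) :
  \det (1%:M + A *m B) = \det (1%:M + B *m A).
Proof.
pose L : 'M[R]_(m + n) := block_mx 1%:M 0 B 1%:M.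
have detL : \det L = 1 by rewrite det_lblock !det1 mulr1.
transitivity (\det (block_mx (1%:M + A *m B) (- A) 0 1%:M *m L)).
  by rewrite det_mulmx detL mulr1 det_ublock det1 mulr1.
transitivity (\det (L *m block_mx 1%:M (- A) 0 (1%:M + B *m A))).
  rewrite !mulmx_block !(mulmx0, mul0mx, mul1mx, mulmx1, add0r, addr0).
  by rewrite mulNmx mulmxN addrK addrCA addNr addr0.
by rewrite det_mulmx detL mul1r det_ublock det1 mul1r.
Qed.

Lemma selection_rowsub (R : realType) (m d : nat) (C : 'M[R]_(m, d)) :
  is_selection C -> exists2 f : 'I_m -> 'I_d, injective f & C = rowsub f 1%:M.
Proof.
move=> [/fin_all_exists[f rowC] Cinj]; exists f.
  by move=> i j fij; apply: Cinj; rewrite /= !rowC fij.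
by apply/row_matrixP => i; rewrite row_rowsub row1 rowC.
Qed.

Lemma selection_mul_tr (R : realType) (m d : nat) (C : 'M[R]_(m, d)) :
  is_selection C -> C *m C^T = 1%:M.
Proof.
move=> /selection_rowsub[f finj ->]; apply/matrixP => i j.
by rewrite mul_rowsub_mx mul1mx !mxE (inj_eq finj) eq_sym.
Qed.

Lemma selection_tr_mul (R : realType) (m d : nat) (f : 'I_m -> 'I_d) :
  injective f -> let C := rowsub f 1%:M : 'M[R]_(m, d) in
  C^T *m C = diag_mx (\row_j (j \in codom f)%:R).
Proof.
move=> finj C; apply/matrixP => a b; rewrite !mxE.
under eq_bigr do rewrite !mxE.
case: (boolP (a \in codom f)) => [/codomP[i ->]|af].
  rewrite (bigD1 i) //= eqxx mul1r big1 ?addr0 // => j ji.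
  by rewrite (inj_eq finj) (negPf ji) mul0r.
rewrite mul0rn big1 // => i _; case: eqP => [E|]; last by rewrite mul0r.
by move: af; rewrite -E codom_f.
Qed.

Lemma row_rowsub1 (R : realType) (m d : nat) (f : 'I_m -> 'I_d) (j : 'I_d) :
  (exists i, row i (rowsub f 1%:M : 'M[R]_(m, d)) = delta_mx 0 j)
  <-> j \in codom f.
Proof.
split=> [[i]|/codomP[i ->]]; last by exists i; rewrite row_rowsub row1.
rewrite row_rowsub row1 => /matrixP/(_ 0 j)/eqP.
rewrite !mxE !eqxx /=; case: (j =P f i) => [-> _|_]; first exact: codom_f.
by rewrite eq_sym oner_eq0.
Qed.

(** Each Gram matrix is the diagonal indicator of the selected indices, and complementarity makes
    the two indicators add up to 1. *)
Lemma complementary_selection_partition (R : realType) (m n d : nat)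
    (C : 'M[R]_(m, d)) (C' : 'M[R]_(n, d)) :
  is_selection C -> is_selection C' -> complementary_selection C C' ->
  C^T *m C + C'^T *m C' = 1%:M.
Proof.
move=> /selection_rowsub[f finj ->] /selection_rowsub[g ginj ->] compl.
rewrite !selection_tr_mul // -linearD /= -diag_const_mx; congr diag_mx.
apply/rowP => j; rewrite !mxE.
have fgj : (j \in codom g) = (j \notin codom f).
  apply/idP/idP => [/(row_rowsub1 R)/(compl j)|] jf.
    by apply/negP => /(row_rowsub1 R).
  by apply/row_rowsub1/(compl j) => /(row_rowsub1 R); apply/negP.
by rewrite fgj; case: (_ \in _); rewrite ?addr0 ?add0r.
Qed.

Lemma complementary_selection_diag (R : realType) (m n d : nat)
    (C : 'M[R]_(m, d)) (C' : 'M[R]_(n, d)) (w : 'rV[R]_d) :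
  is_selection C -> is_selection C' -> complementary_selection C C' ->
  C *m diag_mx w *m C'^T = 0.
Proof.
move=> /selection_rowsub[f finj ->] /selection_rowsub[g ginj ->] compl.
apply/matrixP => i j; rewrite mul_rowsub_mx mul1mx mul_rowsub_mx mul_diag_mx !mxE.
case: eqP => [E|]; last by rewrite mulr0.
have /(row_rowsub1 R) fg : f i \in codom g by rewrite -E codom_f.
by case: (proj1 (compl (f i)) fg); apply/row_rowsub1/codom_f.
Qed.

(** * From the compression problem to the reduced problem *)

(** With [X] the inverse of [P^-1 + K], inserting [P = X + P K X] into [P - X = X K P] gives
    [P - X = X K X + X K P K X], a sum of two semidefinite congruences. *)
Lemma reduced_feasible_invmx_add (R : realType) (n : nat) (P K : 'M[R]_n) :
  posdefmx P -> psdmx K -> reduced_feasible P (invmx (invmx P + K)).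
Proof.
move=> pdP psdK; set B := invmx P + K; set X := invmx B.
have pdB : posdefmx B by apply: posdefmxD => //; exact: posdefmx_inv.
have pdX : posdefmx X by exact: posdefmx_inv.
have uP := posdefmx_unit pdP; have uB := posdefmx_unit pdB.
split=> //; rewrite /lownerle.
have E1 : P = X + X *m K *m P.
  rewrite -mulmxA -[X in X + _]mulmx1 -(mulVmx uP) -mulmxDr -mulmxDl -/B.
  by rewrite mulmxA mulVmx ?mul1mx.
have E2 : P = X + P *m K *m X.
  rewrite -[X in X + _]mul1mx -(mulmxV uP) -mulmxA -mulmxA -mulmxDr -mulmxDl.
  by rewrite mulmxV ?mulmx1.
have -> : P - X = X^T *m K *m X + (K *m X)^T *m P *m (K *m X).
  rewrite trmx_mul (proj1 pdX) (proj1 psdK) {1}E1 addrC addKr {1}E2 mulmxDr.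
  by rewrite !mulmxA.
by apply: psdmxD; apply: psdmx_congr => //; exact: posdefmx_psd.
Qed.

(* Woodbury identity for an update supported on the rows of [C]. *)
Lemma invmx_add_block (R : realType) (m d : nat) (C : 'M[R]_(m, d))
    (P : 'M[R]_d) (K : 'M[R]_m) :
  P \in unitmx -> P^T = P -> block C P C \in unitmx ->
  invmx (block C P C) + K \in unitmx ->
  let G := P *m C^T *m invmx (block C P C) in
  invmx (invmx P + C^T *m K *m C) =
  P + G *m (invmx (invmx (block C P C) + K) - block C P C) *m G^T.
Proof.
move=> uP symP; set B := block C P C => uB uBK G; set X := invmx (_ + K).
have symB : B^T = B by rewrite /B /block !trmx_mul trmxK symP mulmxA.
have CP : C *m P = B *m G^T.
  by rewrite /G !trmx_mul trmxK trmx_inv symP symB mulKVmx.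
have PG : invmx P *m G = C^T *m invmx B by rewrite /G -mulmxA mulKmx.
have CG : C *m G = 1%:M by rewrite /G !mulmxA mulmxV.
clearbody G B; apply: invmx_uniq.
(* After expansion, the terms other than the identity combine to
   [C^T ((B^-1 + K) (X - B) + K B) G^T], which this relation cancels. *)
have : (invmx B + K) *m (X - B) = - (K *m B).
  by rewrite mulmxBr mulmxV // mulmxDl mulVmx // opprD addNKr.
move: (X - B) => Y BKY; rewrite mulmxDl !mulmxDr mulVmx // -addrA -[RHS]addr0.
congr (_ + _); rewrite !mulmxA PG.
have -> : C^T *m K *m C *m P = C^T *m (K *m B) *m G^T.
  by rewrite -!mulmxA CP.
have -> : C^T *m K *m C *m G = C^T *m K by rewrite -mulmxA CG mulmx1.
rewrite -!(mulmxA C^T) addrCA -!mulmxDr -!mulmxDl.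
by rewrite BKY subrr mul0mx mulmx0.
Qed.

Lemma tr_mul_invmx_add_block (R : realType) (m n d : nat)
    (CB : 'M[R]_(m, d)) (CO : 'M[R]_(n, d)) (w : 'rV[R]_d) (P : 'M[R]_d)
    (K : 'M[R]_m) :
  is_selection CB -> is_selection CO -> complementary_selection CB CO ->
  P \in unitmx -> P^T = P -> block CB P CB \in unitmx ->
  invmx (block CB P CB) + K \in unitmx ->
  \tr (diag_mx w *m invmx (invmx P + CB^T *m K *m CB)) =
  \tr (diag_mx w *m P)
  + \tr (tildeW CB CO (diag_mx w) P
         *m (invmx (invmx (block CB P CB) + K) - block CB P CB)).
Proof.
move=> selB selO compl uP symP uB uBK.
set W := diag_mx w; set Wt := tildeW _ _ _ _; set Y := _ - block CB P CB.
rewrite invmx_add_block // -/Y; set G := _ *m invmx (block CB P CB).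
suff <- : G^T *m W *m G = Wt.
  rewrite mulmxDr linearD /= mulmxA [X in _ + X]mxtrace_mulC.
  by rewrite !mulmxA mxtrace_mulC !mulmxA.
pose Q := block CO P CB *m invmx (block CB P CB).
have GE : G = CB^T + CO^T *m Q.
  rewrite -[LHS]mul1mx -(complementary_selection_partition selB selO compl).
  have CBG : CB *m G = 1%:M by rewrite /G !mulmxA mulmxV.
  have COG : CO *m G = Q by rewrite /G /Q /block !mulmxA.
  by rewrite mulmxDl -(mulmxA CB^T) -(mulmxA CO^T) CBG COG mulmx1.
(* A diagonal [W] does not couple the two complementary index sets, so the cross terms of [G^T W G]
   vanish. *)
have BWO : CB *m W *m CO^T = 0 by exact: complementary_selection_diag.
have OWB : CO *m W *m CB^T = 0.
  by apply: trmx_inj; rewrite !trmx_mul trmxK tr_diag_mx mulmxA BWO trmx0.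
have GTE : G^T = CB + Q^T *m CO by rewrite GE linearD /= trmx_mul !trmxK.
have -> : Wt = CB *m W *m CB^T + Q^T *m (CO *m W *m CO^T) *m Q by [].
rewrite GTE GE; clearbody W Q; rewrite !mulmxDl !mulmxDr !mulmxA BWO mul0mx addr0.
by rewrite -!(mulmxA Q^T) OWB mulmx0 add0r !mulmxA.
Qed.

Lemma CD_obj_reduced (R : realType) (dB d n k : nat) (alpha : R)
    (CB : 'M[R]_(dB, d)) (CO : 'M[R]_(n, d)) (w : 'rV[R]_d) (P : 'M[R]_d)
    (Theta : 'M[R]_(k, dB)) (N : 'M[R]_k) :
  is_selection CB -> is_selection CO -> complementary_selection CB CO ->
  posdefmx P -> CD_feasible Theta N ->
  let W := diag_mx w in
  let Wt := tildeW CB CO W P in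
  let PBB := block CB P CB in
  let X := invmx (invmx PBB + Theta^T *m invmx N *m Theta) in
  reduced_feasible PBB X /\
  CD_obj alpha CB W P Theta N = reduced_obj alpha Wt X
    + (\tr (W *m P) - \tr (Wt *m PBB) + alpha / 2 * ln (\det PBB)).
Proof.
move=> selB selO compl pdP [_ _ /is_diag_mxP Ndiag N0] W Wt PBB X.
have pdN : posdefmx N.
  have -> : N = diag_mx (\row_i N i i).
    apply/matrixP => i j; rewrite !mxE; case: eqVneq => [->//|ij].
    by rewrite Ndiag.
  by apply: posdefmx_diag => i; rewrite mxE.
have pdB : posdefmx PBB.
  have := posdefmx_congr (T := CB^T) (selection_mul_tr selB) pdP.
  by rewrite trmxK.
have psdK : psdmx (Theta^T *m invmx N *m Theta).
  by apply: psdmx_congr; apply: posdefmx_psd; exact: posdefmx_inv.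
have [[uP uN] uB] := (posdefmx_unit pdP, posdefmx_unit pdN, posdefmx_unit pdB).
have feasX : reduced_feasible PBB X by exact: reduced_feasible_invmx_add.
split=> //; have pdXi : posdefmx (invmx X).
  by apply: posdefmx_inv; case: feasX.
have uXi := posdefmx_unit pdXi.
rewrite invmxK in pdXi uXi.
set K := Theta^T *m _ *m Theta in psdK feasX pdXi uXi *.
have -> : CD_obj alpha CB W P Theta N =
    \tr (W *m invmx (invmx P + CB^T *m K *m CB))
    + alpha / 2 * ln (\det (Theta *m PBB *m Theta^T + N))
    - alpha / 2 * ln (\det N) by rewrite /CD_obj /PBB /K /block !mulmxA.
rewrite (tr_mul_invmx_add_block _ selB selO compl) ?(proj1 pdP) //.
(* Factor out [N], move to size [dB] by Sylvester's identity, then factor out [PBB]. *)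
have -> : \det (Theta *m PBB *m Theta^T + N)
    = \det N * (\det PBB * \det (invmx PBB + K)).
  have -> : Theta *m PBB *m Theta^T + N
      = N *m (1%:M + invmx N *m Theta *m (PBB *m Theta^T)).
    by rewrite mulmxDr mulmx1 !mulmxA mulmxV // mul1mx addrC.
  rewrite det_mulmx det_add1_mulmxC -det_mulmx mulmxDr mulmxV //.
  by rewrite /K !mulmxA.
rewrite !lnM ?posrE ?mulr_gt0 ?posdefmx_det_gt0 //.
rewrite -/Wt -/PBB -/X mulmxBr linearB /= /reduced_obj.
rewrite {3}/X det_inv lnV ?posrE ?posdefmx_det_gt0 //.
ring.
Qed.

(** * The reduced decomposition and the final theorem *)

(** Under nonnegativity, every eigenvalue that is dropped equals 0. *)
Lemma RSD_tr_mul (R : realType) (n : nat) (V : 'M[R]_n) (lam : 'rV[R]_n) :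
  (forall i, 0 <= lam 0 i) ->
  (RSD V lam).1^T *m (RSD V lam).2 *m (RSD V lam).1 = V^T *m diag_mx lam *m V.
Proof.
move=> lam0; apply/matrixP => i j; rewrite !mul_mx_diag !mxE.
rewrite [RHS](bigID (mem (pos_index lam))) /= [X in _ + X]big1 ?addr0.
  by rewrite [RHS]big_enum_val; apply: eq_bigr => k _; rewrite !mxE.
move=> k; rewrite inE -leNgt => lamk; rewrite !mxE.
by have -> : lam 0 k = 0; [apply/le_anti; rewrite lamk lam0 | rewrite mulr0 mul0r].
Qed.

Lemma RSD_feasible (R : realType) (n : nat) (V : 'M[R]_n) (lam : 'rV[R]_n) :
  V *m V^T = 1%:M -> CD_feasible (RSD V lam).1 (invmx (RSD V lam).2).
Proof.
move=> VVT; have lam0 k : 0 < lam 0 (@enum_val _ (mem (pos_index lam)) k).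
  by have := enum_valP k; rewrite inE.
have -> : invmx (RSD V lam).2
    = diag_mx (\row_k (lam 0 (@enum_val _ (mem (pos_index lam)) k))^-1).
  rewrite /RSD /= invmx_diag => [|k]; last by rewrite mxE lt0r_neq0.
  by congr diag_mx; apply/rowP => k; rewrite !mxE.
split.
- by rewrite -[X in (_ <= X)%N]card_ord max_card.
(* The kept rows are orthonormal: their Gram matrix is a principal submatrix of [V V^T = 1]. *)
- apply/row_freeP; exists (RSD V lam).1^T; apply/matrixP => i j.
  have /matrixP/(_ (enum_val i) (enum_val j)) := VVT.
  rewrite !mxE (inj_eq enum_val_inj) => <-.
  by apply: eq_bigr => k _; rewrite !mxE.
- exact: diag_mx_is_diag.
- by move=> k; rewrite !mxE eqxx mulr1n invr_gt0.
Qed.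

Lemma invmx_diag_congr (R : realType) (n : nat) (e : 'rV[R]_n) (T P : 'M[R]_n) :
  T \in unitmx -> (forall i, 0 < e 0 i) -> T *m P *m T^T = diag_mx e ->
  invmx P = T^T *m diag_mx (\row_i (e 0 i)^-1) *m T.
Proof.
move=> uT e0 TPT; apply: invmx_uniq; apply/mulmx1C.
rewrite -invmx_diag => [|i]; last exact: lt0r_neq0.
have uTPT : T *m P *m T^T \in unitmx.
  by rewrite TPT; apply: posdefmx_unit; exact: posdefmx_diag.
rewrite -TPT; move: (invmx _) (mulVmx uTPT) => Z ZTPT.
(* One-sided inverses of square matrices are two-sided, so the factor [T^T] can be cycled from one
   end of the product to the other. *)
by rewrite -!mulmxA; apply: mulmx1C; rewrite !mulmxA in ZTPT *.
Qed.

Theorem theorem2 (R : realType) (d dB : nat) (alpha : R)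
    (CB : 'M[R]_(dB, d)) (CO : 'M[R]_((d - dB)%N, d)) (Pp : 'M[R]_d)
    (pos : 'I_d -> 'rV[R]_2) (path_cells : {set 'I_d}) (sigma0 : R)
    (S U : 'M[R]_dB) (sigma : 'I_dB -> R)
    (dB_gt0 : (1 <= dB)%N) (dB_le_d : (dB <= d)%N) (alpha_gt0 : 0 < alpha)
    (CB_sel : is_selection CB) (CO_sel : is_selection CO)
    (CBO : complementary_selection CB CO)
    (Pp_pd : posdefmx Pp)
    (path_n0 : path_cells != set0) (sigma0_gt0 : 0 < sigma0) :
  let W := weightmx pos path_cells sigma0 in
  let Wt := tildeW CB CO W Pp in
  let PBB := block CB Pp CB in
  is_sqrtmx S Wt ->
  is_eigendecomp (S *m PBB *m S) U (\row_i sigma i ^+ 2) ->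
  let Phi := diag_mx (\row_i Num.min (alpha / 2) (sigma i ^+ 2)) in
  let Pstar := invmx S *m U^T *m Phi *m U *m invmx S in
  let Sigma := diag_mx (\row_i Num.max 0 (2 / alpha - 1 / sigma i ^+ 2)) in
  let M := invmx Pstar - invmx PBB in
  [/\ forall X : 'M[R]_dB,
        is_minimizer (reduced_feasible PBB) (reduced_obj alpha Wt) X <->
        X = Pstar,
      M = S *m U^T *m Sigma *m U *m S,
      psdmx M &
      forall (V : 'M[R]_dB) (lam : 'rV[R]_dB),
        is_eigendecomp M V lam ->
        CD_optimal alpha CB W Pp (RSD V lam).1 (invmx (RSD V lam).2)].
Proof.
move=> W Wt PBB [pdS SS] [UUT UTU SPS] Phi Pstar Sigma M.
have uS := posdefmx_unit pdS; have symS := proj1 pdS.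
(* This [T] diagonalizes both data at once: [T^T T = Wt] and [T PBB T^T = diag s]. *)
pose T := U *m S; pose s : 'rV[R]_dB := \row_i sigma i ^+ 2.
have uT : T \in unitmx by rewrite unitmx_mul uS andbT; case/mulmx1_unit: UUT.
have TTT : T^T *m T = Wt.
  by rewrite trmx_mul symS -mulmxA (mulmxA U^T) UTU mul1mx.
have TE : T^T = S *m U^T by rewrite trmx_mul symS.
have TPT : T *m PBB *m T^T = diag_mx s.
  rewrite TE /T -(mulmxA U) mulmxA -(mulmxA U) SPS.
  by rewrite !mulmxA UUT mul1mx -mulmxA UUT mulmx1.
have uTT : T^T \in unitmx by rewrite unitmx_tr.
have pdPBB : posdefmx PBB.
  have := posdefmx_congr (T := CB^T) (selection_mul_tr CB_sel) Pp_pd.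
  by rewrite trmxK.
have s0 i : 0 < s 0 i.
  have := posdefmx_congr (mulVmx uTT) pdPBB; rewrite trmxK TPT.
  by move=> /(posdefmx_diag_gt0 i); rewrite mxE eqxx.
have a0 : 0 < alpha / 2 by rewrite divr_gt0.
have PhiE : Phi = diag_mx (\row_i Num.min (alpha / 2) (s 0 i)).
  by congr diag_mx; apply/rowP => i; rewrite !mxE.
have TinvE : invmx T = invmx S *m U^T.
  by apply: invmx_uniq; rewrite -mulmxA mulKVmx.
have PstarE : Pstar = invmx T *m Phi *m (invmx T)^T.
  by rewrite TinvE trmx_mul trmxK trmx_inv symS !mulmxA.
have Pmin X : is_minimizer (reduced_feasible PBB) (reduced_obj alpha Wt) X
    <-> X = Pstar.
  rewrite PstarE PhiE -TTT; exact: reduced_minimizerP.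
have [[pdPs _] Ps_min] := (Pmin Pstar).2 erefl.
(* Both inverses have the form [T^T diag T], so the claim is the scalar identity [1 / min (alpha /
   2) s - 1 / s = max 0 (2 / alpha - 1 / s)]. *)
have ME : M = S *m U^T *m Sigma *m U *m S.
  have TPsT : T *m Pstar *m T^T = Phi by rewrite PstarE congr_invmxK.
  rewrite /M (invmx_diag_congr uT s0 TPT).
  rewrite PhiE in TPsT; rewrite (invmx_diag_congr uT _ TPsT); last first.
    by move=> i; rewrite mxE lt_min a0 s0.
  rewrite -mulmxBl -mulmxBr -linearB /= TE /T !mulmxA.
  congr (_ *m _ *m diag_mx _ *m _ *m _); apply/rowP => i.
  have := s0 i; rewrite !mxE => si0; rewrite div1r.
  case: (leP (alpha / 2)) => [as_|/ltW sa].
    by rewrite invf_div max_r // subr_ge0 -[X in _ <= X]invf_div lef_pV2.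
  by rewrite subrr max_l // subr_le0 -[X in X <= _]invf_div lef_pV2.
have psdM : psdmx M.
  have -> : M = T^T *m Sigma *m T by rewrite ME TE /T !mulmxA.
  apply: psdmx_congr; apply: psdmx_diag => i.
  by rewrite mxE le_max lexx.
split=> // V lam [VVT VTV MV].
(* The eigenvalues are the diagonal entries of [V M V^T], whichever eigen-decomposition is
   chosen. *)
have lam0 i : 0 <= lam 0 i.
  have := psdmx_congr V^T psdM.
  rewrite trmxK MV !mulmxA VVT mul1mx -mulmxA VVT mulmx1.
  by move=> /(psdmx_diag_ge0 i); rewrite mxE eqxx.
have RSD_feas := RSD_feasible lam VVT; split=> // k' Theta' N' feas'.
have [_ ->] := CD_obj_reduced alpha (CO := CO)
  (\row_j weight pos path_cells sigma0 j) CB_sel CO_sel CBO Pp_pd RSD_feas.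
have [redX' ->] := CD_obj_reduced alpha (CO := CO)
  (\row_j weight pos path_cells sigma0 j) CB_sel CO_sel CBO Pp_pd feas'.
(* The common constant cancels, and the RSD pair gives [X = (PBB^-1 + M)^-1 = Pstar]. *)
rewrite lerD2r invmxK RSD_tr_mul // -MV /M addrC subrK invmxK.
exact: Ps_min.
Qed.
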